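(* Let $(\mathbb V,\mathbb E,\mathbf P,\mathcal W)$ be a weighted Markovian graph satisfying assumption (A) (see context). Then for $(l,k)\in\mathbb E$ the partial derivative of the matrix $\mathbf M$ of mean weighted first passage times with respect to the mean weight $\mathbf W(l,k)$ (with $\mathbf P$ held fixed) is $$\frac{\partial\mathbf M}{\partial\mathbf W(l,k)}=\mathbf P(l,k)\Big[\mathbf Z\mathbf e_l\mathbf 1^\top-\mathbf 1\mathbf 1^\top[\mathbf Z\mathbf e_l\mathbf 1^\top]_{\mathrm{dg}}+\boldsymbol\pi(l)\big(\mathbf I-\mathbf Z+\mathbf 1\mathbf 1^\top[\mathbf Z]_{\mathrm{dg}}\big)\Xi^{-1}\Big].$$
   Context: Weighted Markovian graph $(\mathbb V,\mathbb E,\mathbf P,\mathcal W)$: $\mathbb V=\{1,\dots,n\}$; $\mathbb E\subseteq\mathbb V\times\mathbb V$; the graph is strongly connected; $\mathbf P$ is a row-stochastic $n\times n$ matrix with $\mathbf P(i,j)\ge 0$ for $(i,j)\in\mathbb E$ and $\mathbf P(i,j)=0$ otherwise, assumed irreducible and (unless otherwise stated) aperiodic. The weights $\mathcal W(i,j)$ (random, or deterministic as a special case) take values in $[\epsilon,\infty)$ for $(i,j)\in\mathbb E$, for some $\epsilon>0$, and are zero otherwise. Assumption (A): $\mathbf P$ has a unique stationary distribution $\boldsymbol\pi$ (a row vector), and $\mathbf W(i,j)=\mathbb E[\mathcal W(i,j)]<\infty$, $\mathbf W^{(2)}(i,j)=\mathbb E[\mathcal W(i,j)^2]<\infty$ for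 $(i,j)\in\mathbb E$. Let $(\hat X_k)_{k\ge0}$ be the Markov chain with transition matrix $\mathbf P$. For $\hat X_0=i$ let $\hat\tau(i,j)=\inf\{m\ge1:\hat X_m=j\}$ (first return time if $i=j$), and let $\tau(i,j)$ be the sum of the weights $\mathcal W(\hat X_{k-1},\hat X_k)$ over the transitions $k=1,\dots,\hat\tau(i,j)$; the weights are independent of the chain, so a traversal of edge $(a,b)$ has conditional mean weight $\mathbf W(a,b)$. Set $\mathbf M(i,j)=\mathbb E[\tau(i,j)]$; it depends on the weights only through $\mathbf W$ and is regarded as a function of $\mathbf W$. Notation: $\mathbf 1$ is the all-ones column vector; $\mathbf e_l$ is the $l$-th standard basis column vector; $[\cdot]_{\mathrm{dg}}$ sets all off-diagonal entries of a matrix to zero; $\Xi=\mathrm{diag}(\boldsymbol\pi(1),\dots,\boldsymbol\pi(n))$; $\Pi=\mathbf 1\boldsymbol\pi$; $\mathbf Z=(\mathbf I-\mathbf P+\Pi)^{-1}$. *)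

(* Defs.v *)
From HB Require Import structures.
From mathcomp Require Import all_boot all_order all_algebra.
From mathcomp Require Import all_classical all_reals all_analysis.

Set Implicit Arguments.
Unset Strict Implicit.
Unset Printing Implicit Defensive.

Import Order.TTheory GRing.Theory Num.Theory.
Import numFieldNormedType.Exports.

Local Open Scope classical_set_scope.
Local Open Scope ring_scope.

Section MarkovianGraph.
Variables (R : realType) (n : nat).
Implicit Types (E : rel 'I_n) (P : 'M[R]_n) (pi : 'rV[R]_n).

Definition strongly_connected E := forall i j, connect E i j.

Definition row_stochastic P :=
  (forall i j, 0 <= P i j) /\ (forall i, \sum_j P i j = 1).

Definition irreducible P := forall i j, exists m : nat, 0 < (P ^+ m) i j.

(* 1 is the only common divisor of the possible return times to [i], i.e. the
   period of every state is 1. *)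
Definition aperiodic P := forall (i : 'I_n) (d : nat),
  (forall m : nat, (0 < m)%N -> 0 < (P ^+ m) i i -> (d %| m)%N) -> d = 1%N.

(* [E] is only required to contain the support of [P]: an edge may have
   transition probability zero. *)
Definition markovian_graph E P :=
  [/\ strongly_connected E, row_stochastic P,
      forall i j, ~~ E i j -> P i j = 0, irreducible P & aperiodic P].

Definition stationary_distribution P pi :=
  [/\ forall i, 0 <= pi 0 i, \sum_i pi 0 i = 1 & pi *m P = pi].

Definition unique_stationary_distribution P pi :=
  stationary_distribution P pi /\
  forall pi', stationary_distribution P pi' -> pi' = pi.

Definition indep_classes d (T : measurableType d) (Pr : probability T R)
    (F G : set (set T)) :=
  forall A B, F A -> G B -> Pr (A `&` B) = (Pr A * Pr B)%E.

(* The random data of a weighted Markovian graph.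
   - [wg_chain i] is the chain started at [i]; no joint law is imposed on the
     chains started at different states.
   - [wg_wt m a b] is the weight collected at the transition from time [m] to
     time [m.+1] when it traverses the edge [(a, b)]: a copy, identically
     distributed over [m], of the weight of [(a, b)].  Weights drawn once and
     for all ([wg_wt] constant in [m]), weights drawn afresh at each traversal,
     and deterministic weights are all instances.
   - [wg_markov] is the Markov property with the conditional probabilities
     multiplied out. *)
Record weighted_graph E P := WeightedGraph {
  wg_disp : measure_display;
  wg_space : measurableType wg_disp;
  wg_prob : probability wg_space R;
  wg_chain : 'I_n -> nat -> wg_space -> 'I_n;
  wg_wt : nat -> 'I_n -> 'I_n -> {RV wg_prob >-> R};
  wg_chain_meas : forall i m a, measurable (wg_chain i m @^-1` [set a]);
  wg_start : forall i t, wg_chain i 0%N t = i;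
  wg_markov : forall i (m : nat) (x : nat -> 'I_n),
    wg_prob [set t | forall k, (k <= m.+1)%N -> wg_chain i k t = x k] =
    (wg_prob [set t | forall k, (k <= m)%N -> wg_chain i k t = x k] *
     (P (x m) (x m.+1))%:E)%E;
  wg_wt_edge : exists2 eps : R, 0 < eps &
    forall m a b t, E a b -> eps <= wg_wt m a b t;
  wg_wt_nonedge : forall m a b t, ~~ E a b -> wg_wt m a b t = 0;
  wg_wt_law : forall m a b (B : set R), measurable B ->
    wg_prob (wg_wt m a b @^-1` B) = wg_prob (wg_wt 0%N a b @^-1` B);
  wg_indep : forall i, indep_classes wg_prob
    <<s [set A | exists m a, A = wg_chain i m @^-1` [set a]] >>
    <<s [set A | exists m a b (B : set R),
           measurable B /\ A = wg_wt m a b @^-1` B] >>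
}.

Arguments wg_chain {E P} w.
Arguments wg_wt {E P} w.

Section Passage.
Variables (E : rel 'I_n) (P : 'M[R]_n) (G : weighted_graph E P).

Local Notation Pr := (wg_prob G).

Definition mean_weight : 'M[R]_n :=
  \matrix_(a, b) fine ('E_Pr [wg_wt G 0%N a b])%E.

Definition finite_moments := forall a b, E a b ->
  ('E_Pr [wg_wt G 0%N a b] < +oo)%E /\
  ('E_Pr [(fun t => wg_wt G 0%N a b t ^+ 2)%R] < +oo)%E.

Definition assumption_A pi :=
  unique_stationary_distribution P pi /\ finite_moments.

(* [+oo] when [j] is never reached after time 0. *)
Definition hitting_time (i j : 'I_n) (t : wg_space G) : \bar R :=
  ereal_inf [set (m%:R : R)%:E | m in
    [set m : nat | (1 <= m)%N /\ wg_chain G i m t = j]].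

Definition weighted_passage_time (i j : 'I_n) (t : wg_space G) : \bar R :=
  (\sum_(0 <= m <oo | ((m%:R : R)%:E < hitting_time i j t)%E)
    (wg_wt G m (wg_chain G i m t) (wg_chain G i m.+1 t) t)%:E)%E.

Definition mean_passage : 'M[R]_n :=
  \matrix_(i, j) fine (\int[Pr]_t weighted_passage_time i j t)%E.

End Passage.

(* The matrices arising as mean weights of graphs with edge set [E]; the lower
   bound eps on the weights is not fixed in advance, so this set is open in the
   directions [delta_mx l k] with [E l k]. *)
Definition admissible_mean E (W : 'M[R]_n) :=
  forall a b, (E a b -> 0 < W a b) /\ (~~ E a b -> W a b = 0).

Definition dg (A : 'M[R]_n) : 'M[R]_n :=
  \matrix_(i, j) if i == j then A i j else 0.

Definition ones : 'cV[R]_n := const_mx 1.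

Definition fundamental P pi : 'M[R]_n := invmx (1%:M - P + ones *m pi).

End MarkovianGraph.

Arguments ones {R n}.
Arguments wg_chain {R n E P} w.
Arguments wg_wt {R n E P} w.

(* Main.v *)
Require Import Defs.
From HB Require Import structures.
From mathcomp Require Import all_boot all_order all_algebra.
From mathcomp Require Import all_classical all_reals all_analysis.
From mathcomp Require Import measurable_realfun ring.

Set Implicit Arguments.
Unset Strict Implicit.
Unset Printing Implicit Defensive.

Import Order.TTheory GRing.Theory Num.Theory.
Import numFieldNormedType.Exports.

Local Open Scope classical_set_scope.
Local Open Scope ring_scope.

(** A passage from [i] to [j] collects one weight per transition made before time
[tau], the first time from [1] on at which the chain is in [j].  The weights are
independent of the chain, so that the weight of the transition at time [m]
contributes [P a b * W a b] on average whenever the chain is in [a] at time [m]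
with [m < tau].  Hence (lemma [mean_passageE])
[[
  M i j = \sum_(a, b) N_j i a * (P a b * W a b)
]]
where [N_j i a] is the mean number of visits to [a] at the times [m < tau] of the
chain started at [i].  The matrix [N_j] depends on [P] only: the mean passage
times are linear in [W], and their derivative with respect to [W l k] is
[N_j i l * P l k].  All that remains is to compute [N_j].

The probability of being in [a] at time [m] without having visited [j] at the
times [1], ..., [m] is the entry [(i, a)] of [Q ^+ m], where [Q] is [P] with its
column [j] set to zero (lemma [avoids_law]); so [N_j] is the sum of the powers
of [Q].  Let [Y] be the matrix that the formula for the derivative suggests,
[[
  Y i l = Z i l - Z j l + pi l / pi j * ((i == j) - Z i j + Z j j).
]]
The identity [P Z = Z - I + Pi] gives [Y = I + Q Y] (lemma [taboo_greenE]), that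
is [Y = \sum_(k < m) Q ^+ k + Q ^+ m Y] for all [m].  The row sums [h] of [Y]
satisfy [h = 1 + Q h]; a minimum principle makes them nonnegative, so that they
bound the row sums of the partial sums.  Therefore the powers of [Q] tend to [0],
their series converges to [Y] (lemma [neumann_cvg]), and [N_j = Y]. *)

(** * Irreducible stochastic matrices *)

Section Stochastic.
Variables (R : realType) (n : nat) (P : 'M[R]_n) (pi : 'rV[R]_n).

Lemma expmx_ge0 (A : 'M[R]_n) m i j :
  (forall a b, 0 <= A a b) -> 0 <= (A ^+ m) i j.
Proof.
move=> A0; elim: m i j => [|m IH] i j; first by rewrite expr0 !mxE ler0n.
by rewrite exprS mxE sumr_ge0// => k _; rewrite mulr_ge0.
Qed.

Lemma expmx_fixed_col (u : 'cV[R]_n) m : P *m u = u -> P ^+ m *m u = u.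
Proof.
move=> Pu; elim: m => [|m IH]; first by rewrite expr0 mul1mx.
by rewrite exprSr -mulmxA Pu.
Qed.

Lemma expmx_fixed_row (v : 'rV[R]_n) m : v *m P = v -> v *m P ^+ m = v.
Proof.
move=> vP; elim: m => [|m IH]; first by rewrite expr0 mulmx1.
by rewrite exprS mulmxA vP.
Qed.

Hypothesis Psto : row_stochastic P.

Lemma stochastic_ones : P *m ones = ones.
Proof.
apply/matrixP => i j; rewrite !mxE -[RHS](Psto.2 i).
by apply: eq_bigr => k _; rewrite mxE mulr1.
Qed.

Hypothesis Pirr : irreducible P.

(** The maximum principle: for every [m], the value at a maximiser is the average of
the values under a row of [P ^+ m], so it is attained wherever this row is positive;
by irreducibility, every state is reached by some [m]. *)
Lemma harmonic_const (u : 'cV[R]_n) i j : P *m u = u -> u i 0 = u j 0.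
Proof.
move=> Pu.
have [i0 i0max] : exists i0, forall k, u k 0 <= u i0 0.
  by exists [arg max_(k > i) u k 0]%O; case: arg_maxP => // x _ + k; apply.
suff umax k : u k 0 = u i0 0 by rewrite !umax.
have [m Pm] := Pirr i0 k.
have terms_ge0 x : true -> 0 <= (P ^+ m) i0 x * (u i0 0 - u x 0).
  by move=> _; rewrite mulr_ge0 ?subr_ge0//; apply: expmx_ge0; case: Psto.
have sum0 : \sum_x (P ^+ m) i0 x * (u i0 0 - u x 0) = 0.
  have /matrixP/(_ i0 0) E1 := expmx_fixed_col m Pu.
  have /matrixP/(_ i0 0) E2 := expmx_fixed_col m stochastic_ones.
  rewrite !mxE in E1 E2.
  under eq_bigr do rewrite mulrBr.
  rewrite sumrB E1 -mulr_suml.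
  rewrite (eq_bigr (fun x => (P ^+ m) i0 x * ones x 0)) ?E2 ?mul1r ?subrr//.
  by move=> x _; rewrite mxE mulr1.
have /(_ k isT)/eqP := psumr_eq0P terms_ge0 sum0.
by rewrite mulf_eq0 gt_eqF//= subr_eq0 => /eqP ->.
Qed.

Hypothesis pistat : stationary_distribution P pi.

Lemma stationary_gt0 j : 0 < pi 0 j.
Proof.
have [pi0 pi1 piP] := pistat.
have [i pii] : exists i, 0 < pi 0 i.
  apply/existsP; apply: contraT => /existsPn pi_le0.
  move: pi1; rewrite big1; first by move/eqP; rewrite eq_sym oner_eq0.
  by move=> i _; apply/le_anti; rewrite pi0 leNgt pi_le0.
have [m Pm] := Pirr i j.
rewrite -(expmx_fixed_row m piP) mxE (bigD1 i)//=.
rewrite ltr_wpDr ?mulr_gt0// sumr_ge0// => k _.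
by rewrite mulr_ge0//; apply: expmx_ge0; case: Psto.
Qed.

Lemma stationary_ones : pi *m ones = 1%:M.
Proof.
apply/matrixP => i j; rewrite !ord1 !mxE /=.
have [_ <- _] := pistat.
by apply: eq_bigr => k _; rewrite mxE mulr1.
Qed.

(** If [(I - P + Pi) u = 0], then multiplying by [pi] gives [pi u = 0]; hence [u]
is [P]-harmonic, so it is constant, and its value is [pi u = 0]. *)
Lemma fundamental_unit : 1%:M - P + ones *m pi \in unitmx.
Proof.
have [pi0 pi1 piP] := pistat.
rewrite -unitmx_tr -row_free_unit; apply: inj_row_free => v vA.
pose u := v^T.
have Au : (1%:M - P + ones *m pi) *m u = 0.
  by apply: trmx_inj; rewrite trmx_mul /u trmxK vA trmx0.
have piu : pi *m u = 0.
  have := congr1 (mulmx pi) Au.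
  rewrite mulmxA mulmxDr mulmxBr mulmx1 piP subrr add0r mulmxA stationary_ones.
  by rewrite mul1mx mulmx0.
have Pu : P *m u = u.
  move: Au; rewrite mulmxDl mulmxBl mul1mx -mulmxA piu mulmx0 addr0.
  by move/eqP; rewrite subr_eq0 => /eqP.
apply/rowP => i; rewrite [RHS]mxE.
have /matrixP/(_ 0 0) := piu; rewrite !mxE.
rewrite (eq_bigr (fun k => pi 0 k * v 0 i)).
  by rewrite -mulr_suml pi1 mul1r.
by move=> k _; rewrite (harmonic_const k i Pu) mxE.
Qed.

Lemma stationary_fundamental : pi *m fundamental P pi = pi.
Proof.
have [_ _ piP] := pistat.
rewrite -[RHS](mulmxK fundamental_unit); congr (_ *m _).
by rewrite mulmxDr mulmxBr mulmx1 piP subrr add0r mulmxA stationary_ones mul1mx.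
Qed.

Lemma mul_fundamental :
  P *m fundamental P pi = fundamental P pi - 1%:M + ones *m pi.
Proof.
have := mulmxV fundamental_unit.
rewrite mulmxDl mulmxBl mul1mx -mulmxA stationary_fundamental => <-.
by rewrite opprD addrA subrK opprB addrC subrK.
Qed.

End Stochastic.

(** * Visits before the first passage *)

Section Taboo.
Variables (R : realType) (n : nat).
Implicit Types (P Q Y : 'M[R]_n) (pi : 'rV[R]_n).

(** The chain killed on entering [j].  The row [j] is kept, since the first return
to [j] starts there. *)
Definition taboo P (j : 'I_n) : 'M[R]_n :=
  \matrix_(a, b) if b == j then 0 else P a b.

(** The Green matrix of the chain killed on entering [j]: the entry [(i, l)] is the
mean number of visits to [l] strictly before the first passage from [i] to [j]. *)
Definition taboo_green P pi (j : 'I_n) : 'M[R]_n :=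
  let Z := fundamental P pi in
  \matrix_(i, l) (Z i l - Z j l
    + pi 0 l / pi 0 j * ((i == j)%:R - Z i j + Z j j)).

(** First-step analysis.  Since [P Z = Z - I + Pi] and [P] fixes constant columns,
[Y - P Y] has the entry [(i == l) - pi l / pi j * P i j]; the last term is what
zeroing the column [j] of [P] removes, because [Y j l = pi l / pi j]. *)
Lemma taboo_greenE P pi j :
  row_stochastic P -> irreducible P -> stationary_distribution P pi ->
  taboo_green P pi j = 1%:M + taboo P j *m taboo_green P pi j.
Proof.
move=> Psto Pirr pistat; set Z := fundamental P pi.
have [Y YE defY] : exists2 Y, taboo_green P pi j = Y & forall a b, Y a b =
    Z a b - Z j b + pi 0 b / pi 0 j * ((a == j)%:R - Z a j + Z j j).
  by exists (taboo_green P pi j) => // a b; rewrite mxE.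
rewrite YE.
have pij : pi 0 j != 0 by rewrite gt_eqF// (stationary_gt0 Psto Pirr pistat).
have PZ a b : \sum_c P a c * Z c b = Z a b - (a == b)%:R + pi 0 b.
  have /matrixP/(_ a b) := mul_fundamental Psto Pirr pistat.
  by rewrite !mxE big_ord1 mxE mul1r.
apply/matrixP => i l.
have -> : (1%:M + taboo P j *m Y) i l
    = (i == l)%:R + (\sum_c P i c * Y c l - P i j * Y j l).
  rewrite !mxE; congr (_ + _).
  rewrite (bigD1 j)//= [in RHS](bigD1 j)//= [RHS]addrAC subrr add0r.
  rewrite [taboo P j i j]mxE eqxx mul0r add0r.
  apply: eq_bigr => c /negPf cj.
  by rewrite [taboo P j i c]mxE cj.
have -> : \sum_c P i c * Y c l = Z i l - (i == l)%:R + pi 0 l - Z j l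
    + pi 0 l / pi 0 j * (P i j - (Z i j - (i == j)%:R + pi 0 j) + Z j j).
  rewrite -!PZ.
  transitivity (\sum_c (P i c * Z c l - P i c * Z j l
     + pi 0 l / pi 0 j * (P i c * (c == j)%:R - P i c * Z c j + P i c * Z j j))).
    by apply: eq_bigr => c _; rewrite defY; ring.
  rewrite big_split sumrB/= -mulr_suml Psto.2 mul1r -mulr_sumr big_split sumrB/=.
  rewrite -[in X in _ + _ * (_ + X)]mulr_suml Psto.2 mul1r.
  rewrite [X in _ * (X - _ + _)](_ : _ = P i j)//.
  rewrite (bigD1 j)//= eqxx mulr1 big1 ?addr0// => c /negPf ->.
  by rewrite mulr0.
rewrite !defY eqxx mulr1n; field.
exact: pij.
Qed.

Section Neumann.
Variables (Q Y : 'M[R]_n).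
Hypothesis Q0 : forall a b, 0 <= Q a b.
Hypothesis Q1 : forall a, \sum_b Q a b <= 1.
Hypothesis YQ : Y = 1%:M + Q *m Y.

Lemma neumann_partial m : \sum_(k < m) Q ^+ k = Y - Q ^+ m *m Y.
Proof.
elim: m => [|m IH]; first by rewrite big_ord0 expr0 mul1mx subrr.
rewrite big_ord_recr/= IH exprSr -mulmxA {2}YQ mulmxDr mulmx1.
by rewrite opprD addrA addrAC subrK.
Qed.

(** A minimum principle for the solution [h = 1 + Q h] given by the row sums: at a
state where [h] is minimal, a negative value would exceed itself by [1]. *)
Lemma neumann_row_ge0 i : 0 <= \sum_l Y i l.
Proof.
pose h a := \sum_l Y a l.
have hE a : h a = 1 + \sum_b Q a b * h b.
  rewrite /h {1}YQ.
  under eq_bigr do rewrite !mxE.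
  rewrite big_split/= exchange_big/=; congr (_ + _).
    rewrite (bigD1 a)//= eqxx big1 ?addr0// => b /negPf.
    by rewrite eq_sym => ->.
  by apply: eq_bigr => b _; rewrite mulr_sumr.
have [i0 i0min] : exists i0, forall a, h i0 <= h a.
  by exists [arg min_(a < i) h a]%O; case: arg_minP => // x _ + k; apply.
apply: le_trans (i0min i); rewrite leNgt; apply/negP => h_lt0.
suff : 1 + h i0 <= h i0 by rewrite gerDr ler10.
rewrite [leRHS]hE lerD2l.
apply: (@le_trans _ _ (\sum_b Q i0 b * h i0)).
  by rewrite -mulr_suml -[leLHS]mul1r ler_nM2r.
by apply: ler_sum => b _; rewrite ler_wpM2l.
Qed.

Lemma neumann_bounded m i l : \sum_(k < m) (Q ^+ k) i l <= \sum_b Y i b.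
Proof.
have QE b : \sum_(k < m) (Q ^+ k) i b = (\sum_(k < m) Q ^+ k) i b.
  by rewrite summxE.
apply: (@le_trans _ _ (\sum_b \sum_(k < m) (Q ^+ k) i b)).
  rewrite [leRHS](bigD1 l)//= lerDl sumr_ge0// => b _.
  by rewrite sumr_ge0// => k _; exact: expmx_ge0.
under eq_bigr do rewrite QE neumann_partial mxE [X in _ + X]mxE [(_ *m _) _ _]mxE.
rewrite sumrB gerBl exchange_big/= sumr_ge0// => a _.
by rewrite -mulr_sumr mulr_ge0 ?neumann_row_ge0//; exact: expmx_ge0.
Qed.

(** A solution of [Y = I + Q Y] is the sum of the powers of [Q] as soon as [Q] is
substochastic: the row sums of [Y] are nonnegative, hence bound the partial sums,
so that the powers of [Q] tend to zero and so does the remainder [Q ^+ m *m Y]. *)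
Lemma neumann_cvg i l : series (fun k => (Q ^+ k) i l) @ \oo --> Y i l.
Proof.
have Qm0 a b : (fun k => (Q ^+ k) a b) @ \oo --> (0 : R).
  apply: cvg_series_cvg_0; apply: nondecreasing_is_cvgn.
    apply: nondecreasing_series => k _ _; exact: expmx_ge0.
  exists (\sum_c Y a c) => _ [m _ <-]; rewrite /series/= big_mkord.
  exact: neumann_bounded.
rewrite [X in X @ \oo --> _](_ : _ =
    fun m => Y i l - \sum_a (Q ^+ m) i a * Y a l); last first.
  apply/funext => m; rewrite /series/= big_mkord -summxE neumann_partial.
  by rewrite !mxE.
rewrite -[X in _ --> X]subr0; apply: cvgB; first exact: cvg_cst.
rewrite [X in _ --> X](_ : 0 = \sum_(a < n) 0 * Y a l); last first.
  by rewrite big1// => a _; rewrite mul0r.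
apply: cvg_big => [|a _]; first exact: add_continuous.
by apply: cvgM; [exact: Qm0|exact: cvg_cst].
Qed.

End Neumann.

Lemma taboo_green_cvg P pi j i l :
  row_stochastic P -> irreducible P -> stationary_distribution P pi ->
  series (fun m => (taboo P j ^+ m) i l) @ \oo --> taboo_green P pi j i l.
Proof.
move=> Psto Pirr pistat; apply: neumann_cvg; last exact: taboo_greenE.
  by move=> a b; rewrite mxE; case: ifP => // _; case: Psto.
move=> a; rewrite -(Psto.2 a); apply: ler_sum => b _; rewrite mxE.
by case: ifP => // _; case: Psto.
Qed.

End Taboo.

(** * Events of a finite-state process *)

Section FinitePartition.
Context d (T : measurableType d) (I : finType) (F : T -> I).
Hypothesis mF : forall c, measurable (F @^-1` [set c]).

Lemma measurable_fin_preimage (S : set I) : measurable (F @^-1` S).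
Proof.
rewrite (_ : F @^-1` S = \bigcup_(c in S) F @^-1` [set c]).
  by apply: fin_bigcup_measurable => // c _; exact: mF.
by apply/seteqP; split=> [t St|t [c Sc /= ->]//]; exists (F t).
Qed.

Lemma measure_fin_partition (R : realType) (mu : {measure set T -> \bar R})
    (A : set T) : measurable A ->
  mu A = (\sum_c mu (A `&` F @^-1` [set c]))%E.
Proof.
move=> mA; rewrite [in LHS](_ : A = \bigcup_(c in setT) (A `&` F @^-1` [set c])).
  rewrite measure_fin_bigcup; first last.
  - by move=> c _; exact: measurableI.
  - by move=> c c' _ _ [t [[_ /= <-] [_ /= <-]]].
  - exact: finite_finset.
  - rewrite (fsbig_seq _ _ (index_enum_uniq I)); congr (\big[_/_]_(_ \in _) _).
    by apply/seteqP; split=> c _ //=; rewrite mem_index_enum.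
by apply/seteqP; split=> [t At|t [c _ []]//]; exists (F t).
Qed.

End FinitePartition.

Definition trajectory T n (X : nat -> T -> 'I_n) m (t : T) :
  {ffun 'I_m.+1 -> 'I_n} := [ffun k : 'I_m.+1 => X k t].

(** Time [0] is left out because the passage from [j] to itself is a return. *)
Definition avoids T n (X : nat -> T -> 'I_n) (j : 'I_n) m : set T :=
  [set t | forall k, (0 < k <= m)%N -> X k t <> j].

Lemma avoids_trajectory T n (X : nat -> T -> 'I_n) j m :
  avoids X j m = trajectory X m @^-1`
    [set p | forall k : 'I_m.+1, (0 < k)%N -> p k <> j].
Proof.
apply/seteqP; split=> t /= av k.
  by move=> k0; rewrite ffunE; apply: av; rewrite k0 -ltnS /=.
move=> /andP[k0 km]; have := av (inord k); rewrite ffunE inordK//.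
exact.
Qed.

Section ProcessEvents.
Context d (T : measurableType d) (n : nat) (X : nat -> T -> 'I_n).
Hypothesis mX : forall m a, measurable (X m @^-1` [set a]).

Lemma measurable_trajectory m (S : set {ffun 'I_m.+1 -> 'I_n}) :
  measurable (trajectory X m @^-1` S).
Proof.
apply: measurable_fin_preimage => p.
rewrite (_ : _ @^-1` _ = \bigcap_(k in setT) X (val k) @^-1` [set p k]).
  apply: fin_bigcap_measurable => [|k _]; [exact: finite_finset|exact: mX].
apply/seteqP; split=> t /=; first by move=> <- k _; rewrite /= ffunE.
by move=> Xp; apply/ffunP => k; rewrite ffunE Xp.
Qed.

Lemma measurable_avoids j m : measurable (avoids X j m).
Proof. by rewrite avoids_trajectory; exact: measurable_trajectory. Qed.

Lemma measurable_avoids_step j m a b :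
  measurable (avoids X j m `&` X m @^-1` [set a] `&` X m.+1 @^-1` [set b]).
Proof. by do !apply: measurableI => //; exact: measurable_avoids. Qed.

End ProcessEvents.

(** * Independence and expectations *)

(** Away from [0], the law of [\1_A * X] is the law of [X] scaled by the probability
of [A], and [0] does not contribute to the expectation. *)
Lemma integral_indic_indep d (T : measurableType d) (R : realType)
    (Pr : probability T R) (X : {RV Pr >-> R}) (A : set T) :
    measurable A -> (forall t, 0 <= X t) ->
    (forall B, measurable B ->
      Pr (A `&` X @^-1` B) = (Pr A * Pr (X @^-1` B))%E) ->
  (\int[Pr]_t (\1_A t * X t)%:E = Pr A * \int[Pr]_t (X t)%:E)%E.
Proof.
move=> mA X0 AX.
have mX : measurable_fun [set: T] X by [].
have mAX : measurable_fun [set: T] (fun t => \1_A t * X t).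
  by apply: measurable_funM => //; exact: measurable_indic.
have AX0 t : 0 <= \1_A t * X t by rewrite mulr_ge0.
pose D : set R := ~` [set 0].
have mD : measurable D by apply: measurableC.
(* The absolute value makes the identity nonnegative on the whole line without
   changing it on the values of [X]. *)
pose f (x : R) : \bar R := `|x|%:E.
have mf : measurable_fun D f.
  by apply: measurable_funTS; apply/measurable_EFinP; exact: normr_measurable.
have law (Y : T -> R) : measurable_fun [set: T] Y -> (forall t, 0 <= Y t) ->
    (\int[Pr]_t (Y t)%:E = \int[pushforward Pr Y]_(y in D) f y)%E.
  move=> mY Y0; rewrite ge0_integral_pushforward//; last first.
    by move=> x _; rewrite lee_fin normr_ge0.
  rewrite [RHS]integral_mkcond; apply: eq_integral => t _.
  rewrite patchE/= /f ger0_norm//; case: ifPn => //.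
  by rewrite notin_setE /= /D /= => /contrapT ->.
rewrite (law _ mAX AX0) (law _ mX X0).
have PrA : (Pr A = (fine (Pr A))%:E)%E by rewrite fineK// fin_num_measure.
have p0 : 0 <= fine (Pr A) by rewrite fine_ge0.
rewrite PrA -[fine (Pr A)]/((NngNum p0)%:num) -ge0_integral_mscale//; last first.
  by move=> x _; rewrite lee_fin normr_ge0.
apply: eq_measure_integral => B mB BD.
transitivity (Pr A * Pr (X @^-1` B))%E; last by rewrite {1}PrA.
rewrite /pushforward -AX//; congr (Pr _).
apply/seteqP; split=> t /=; rewrite indicE.
  have [tA|tA] := boolP (t \in A); rewrite ?mul1r ?mul0r.
    by move=> BXt; split=> //; exact: set_mem.
  by move=> /BD/(_ erefl).
by move=> [/mem_set -> ]; rewrite mul1r.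
Qed.

(** * The chain up to its first passage *)

Section Chain.
Variables (R : realType) (n : nat) (E : rel 'I_n) (P : 'M[R]_n).
Variables (G : weighted_graph E P) (i j : 'I_n).
Hypothesis Psto : row_stochastic P.

Local Notation Pr := (wg_prob G).
Local Notation X := (wg_chain G i).

Let mX m a : measurable (X m @^-1` [set a]).
Proof. exact: wg_chain_meas. Qed.

(** The Markov property for an arbitrary event of the past, obtained by summing
over the trajectories that make it up. *)
Lemma markov_past m (S : set {ffun 'I_m.+1 -> 'I_n}) a b :
  Pr (trajectory X m @^-1` S `&` X m @^-1` [set a] `&` X m.+1 @^-1` [set b]) =
  (Pr (trajectory X m @^-1` S `&` X m @^-1` [set a]) * (P a b)%:E)%E.
Proof.
have mtraj (S' : set {ffun 'I_m.+1 -> 'I_n}) :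
    measurable (trajectory X m @^-1` S') by exact: measurable_trajectory.
have mSa : measurable (trajectory X m @^-1` S `&` X m @^-1` [set a]).
  exact: measurableI.
rewrite (measure_fin_partition (F := trajectory X m))//; last first.
  exact: measurableI.
rewrite [in RHS](measure_fin_partition (F := trajectory X m))//.
rewrite ge0_sume_distrl; last by move=> p _; exact: measure_ge0.
apply: eq_bigr => p _.
have [[Sp pa]|nSp] := pselect (S p /\ p ord_max = a); last first.
  rewrite (_ : _ `&` _ `&` _ `&` _ = set0); last first.
    apply/seteqP; split=> t //= [[[St Xa] _] tp]; apply: nSp.
    by rewrite -tp; split=> //; rewrite ffunE.
  rewrite (_ : _ `&` _ `&` _ = set0); last first.
    apply/seteqP; split=> t //= [[St Xa] tp]; apply: nSp.
    by rewrite -tp; split=> //; rewrite ffunE.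
  by rewrite measure0 mul0e.
(* The path [p] followed by a step to [b]. *)
pose x k := if (k <= m)%N then p (inord k) else b.
have xm : x m = a.
  by rewrite /x leqnn -pa; congr (p _); apply: val_inj; rewrite /= inordK.
have xm1 : x m.+1 = b by rewrite /x ltnn.
have := wg_markov G i m x; rewrite xm xm1.
have -> : [set t | forall k, (k <= m)%N -> X k t = x k] =
    trajectory X m @^-1` S `&` X m @^-1` [set a] `&` trajectory X m @^-1` [set p].
  apply/seteqP; split=> t /=.
    move=> Xx; have tp : trajectory X m t = p.
      apply/ffunP => k; have km : (k <= m)%N by rewrite -ltnS.
      by rewrite ffunE Xx// /x km inord_val.
    by rewrite tp Xx.
  by move=> [_ tp] k km; rewrite /x km -tp ffunE inordK.
have -> // : [set t | forall k, (k <= m.+1)%N -> X k t = x k] =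
    trajectory X m @^-1` S `&` X m @^-1` [set a] `&` X m.+1 @^-1` [set b]
      `&` trajectory X m @^-1` [set p].
apply/seteqP; split=> t /=.
  move=> Xx; have tp : trajectory X m t = p.
    apply/ffunP => k; have km : (k <= m)%N by rewrite -ltnS.
    by rewrite ffunE Xx ?leqW// /x km inord_val.
  by rewrite tp !Xx.
move=> [[_ Xb] tp] k; rewrite leq_eqVlt => /predU1P[->|]; first by rewrite xm1.
by rewrite ltnS /x => km; rewrite km -tp ffunE inordK.
Qed.

Lemma avoids_step m a b :
  Pr (avoids X j m `&` X m @^-1` [set a] `&` X m.+1 @^-1` [set b]) =
  (Pr (avoids X j m `&` X m @^-1` [set a]) * (P a b)%:E)%E.
Proof. by rewrite avoids_trajectory markov_past. Qed.

(** By the Markov property, one more step multiplies by [P], and not entering [j]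
at that step zeroes the column [j]. *)
Lemma avoids_law m a :
  Pr (avoids X j m `&` X m @^-1` [set a]) = ((taboo P j ^+ m) i a)%:E.
Proof.
elim: m a => [|m IH] a.
  rewrite expr0 !mxE (_ : _ `&` _ = [set _ | i == a]).
    by case: eqP => _; rewrite ?set_true ?set_false ?probability_setT ?measure0.
  apply/seteqP; split=> t /=; rewrite wg_start; first by move=> [_ ->].
  by move=> /eqP ->; split=> // k; rewrite leqn0 lt0n => /andP[/negPf ->].
rewrite exprSr mxE; have [->|aj] := eqVneq a j.
  rewrite (_ : _ `&` _ = set0) ?measure0 ?big1//.
    by move=> c _; rewrite mxE eqxx mulr0.
  by apply/seteqP; split=> t //= [/(_ m.+1)]; rewrite leqnn => /(_ isT).
rewrite (_ : _ `&` _ = avoids X j m `&` X m.+1 @^-1` [set a]); last first.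
  apply/seteqP; split=> t [av Xa]; split=> // k /andP[k0].
    by move=> km; apply: av; rewrite k0 leqW.
  rewrite leq_eqVlt => /predU1P[->|]; first by rewrite Xa; exact/eqP.
  by rewrite ltnS => km; apply: av; rewrite k0.
have mA : measurable (avoids X j m) by exact: measurable_avoids.
rewrite (measure_fin_partition (F := X m))//; last exact: measurableI.
rewrite -sumEFin; apply: eq_bigr => c _.
rewrite setIAC [taboo P j c a]mxE (negPf aj) EFinM -IH; exact: avoids_step.
Qed.

Lemma lt_hitting_timeE m (t : wg_space G) :
  ((m%:R : R)%:E < hitting_time i j t)%E <-> avoids X j m t.
Proof.
split=> [lt_m k /andP[k0 km] Xj|av].
  have : (hitting_time i j t <= (k%:R : R)%:E)%E.
    by apply: ereal_inf_lbound; exists k.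
  by move=> /(lt_le_trans lt_m); rewrite lte_fin ltr_nat ltnNge km.
apply: (@lt_le_trans _ _ (m.+1%:R : R)%:E); first by rewrite lte_fin ltr_nat.
apply/ereal_infP => _ [k [k0 Xj] <-]; rewrite lee_fin ler_nat ltnNge.
by apply/negP => km; apply: (av k) => //; rewrite k0.
Qed.

Local Notation step_event m e :=
  (avoids X j m `&` X m @^-1` [set e.1] `&` X m.+1 @^-1` [set e.2]).

Lemma wg_wt_ge0 m a b t : 0 <= wg_wt G m a b t.
Proof.
have [Eab|/wg_wt_nonedge ->//] := boolP (E a b).
have [eps eps0 wt_eps] := wg_wt_edge G.
exact: le_trans (ltW eps0) (wt_eps _ _ _ _ Eab).
Qed.

(** Splitting each transition according to the edge it traverses separates the
events, which concern the chain, from the weights of fixed edges. *)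
Lemma weighted_passage_timeE (t : wg_space G) :
  weighted_passage_time i j t =
  (\sum_(0 <= m <oo) \sum_(e : 'I_n * 'I_n)
    (\1_(step_event m e) t * wg_wt G m e.1 e.2 t)%:E)%E.
Proof.
rewrite /weighted_passage_time eseries_mkcond; apply: eq_eseriesr => m _.
case: ifPn => [/lt_hitting_timeE av|nav].
  rewrite (bigD1 (X m t, X m.+1 t))//= big1 ?adde0.
    by rewrite indicE mem_set ?mul1r.
  move=> [a b] /= ne; rewrite indicE memNset ?mul0r// => -[[_ /= Xa] Xb].
  by rewrite Xa Xb eqxx in ne.
rewrite big1// => e _; rewrite indicE memNset ?mul0r// => -[[av _] _].
by move/negP: nav; apply; exact/lt_hitting_timeE.
Qed.

Hypothesis finG : finite_moments G.

Lemma integral_wt m a b :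
  (\int[Pr]_t (wg_wt G m a b t)%:E = (mean_weight G a b)%:E)%E.
Proof.
have same_law : (\int[Pr]_t (wg_wt G m a b t)%:E =
                 \int[Pr]_t (wg_wt G 0%N a b t)%:E)%E.
  have wtE k : (\int[Pr]_t (wg_wt G k a b t)%:E =
      \int[pushforward Pr (wg_wt G k a b)]_y `|y|%:E)%E.
    rewrite ge0_integral_pushforward//.
      by apply: eq_integral => t _ /=; rewrite ger0_norm// wg_wt_ge0.
    by apply/measurable_EFinP; exact: normr_measurable.
  by rewrite !wtE; apply: eq_measure_integral => B mB _; exact: wg_wt_law.
rewrite same_law mxE unlock fineK//.
have [Eab|nE] := boolP (E a b); last first.
  by under eq_integral do rewrite wg_wt_nonedge//; rewrite integral0.
have [] := finG Eab; rewrite unlock => fin _.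
rewrite ge0_fin_numE//; apply: integral_ge0 => t _.
by rewrite lee_fin wg_wt_ge0.
Qed.

Lemma integral_step m (e : 'I_n * 'I_n) :
  (\int[Pr]_t (\1_(step_event m e) t * wg_wt G m e.1 e.2 t)%:E =
   ((taboo P j ^+ m) i e.1 * (P e.1 e.2 * mean_weight G e.1 e.2))%:E)%E.
Proof.
have mA : measurable (step_event m e) by exact: measurable_avoids_step.
rewrite integral_indic_indep//; last 2 first.
- by move=> t; exact: wg_wt_ge0.
- move=> B mB; apply: (wg_indep (w := G) (i := i)).
    pose gens := [set A | exists m a, A = X m @^-1` [set a]].
    apply: (@measurable_avoids_step _ (g_sigma_algebraType gens)) => k a.
    by apply: sub_sigma_algebra; exists k, a.
  by apply: sub_sigma_algebra; exists m, e.1, e.2, B.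
by rewrite avoids_step avoids_law integral_wt !EFinM muleA.
Qed.

Variable pi : 'rV[R]_n.
Hypothesis Pirr : irreducible P.
Hypothesis pistat : stationary_distribution P pi.

(** Tonelli exchanges the expectation with the sum over the times, and the sum over
the times of the powers of the taboo matrix is its Green matrix. *)
Lemma mean_passageE :
  mean_passage G i j = \sum_(e : 'I_n * 'I_n)
    taboo_green P pi j i e.1 * (P e.1 e.2 * mean_weight G e.1 e.2).
Proof.
rewrite mxE; under eq_integral do rewrite weighted_passage_timeE.
have mstep m (e : 'I_n * 'I_n) : measurable_fun [set: wg_space G]
    (fun t => (\1_(step_event m e) t * wg_wt G m e.1 e.2 t)%:E).
  apply/measurable_EFinP/measurable_funM => //; apply: measurable_indic.
  exact: measurable_avoids_step.
have step0 m (e : 'I_n * 'I_n) t :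
    (0 <= (\1_(step_event m e) t * wg_wt G m e.1 e.2 t)%:E)%E.
  by rewrite lee_fin mulr_ge0 ?wg_wt_ge0.
rewrite integral_nneseries//; last 2 first.
- by move=> m; apply: emeasurable_sum.
- by move=> m t _; apply: sume_ge0.
under eq_eseriesr => m _.
  rewrite ge0_integral_sum//; under eq_bigr do rewrite integral_step.
  rewrite sumEFin; over.
suff cvgM : series (fun m => \sum_(e : 'I_n * 'I_n)
      (taboo P j ^+ m) i e.1 * (P e.1 e.2 * mean_weight G e.1 e.2)) @ \oo -->
    \sum_(e : 'I_n * 'I_n)
      taboo_green P pi j i e.1 * (P e.1 e.2 * mean_weight G e.1 e.2).
  rewrite -(cvg_lim _ cvgM)// -[RHS]/(fine (limn _)%:E) -EFin_lim; last first.
    by apply/cvg_ex; eexists; exact: cvgM.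
  by congr (fine (limn _)); apply/funext => m; rewrite /= /series/= sumEFin.
rewrite [X in X @ \oo --> _](_ : _ = fun N => \sum_(e : 'I_n * 'I_n)
    series (fun m => (taboo P j ^+ m) i e.1) N *
      (P e.1 e.2 * mean_weight G e.1 e.2)); last first.
  apply/funext => N; rewrite /series/= exchange_big/=.
  by apply: eq_bigr => e _; rewrite mulr_suml.
apply: cvg_big => [|e _]; first exact: add_continuous.
by apply: cvgM; [exact: taboo_green_cvg|exact: cvg_cst].
Qed.

End Chain.

(** * Differentiation in the mean weights *)

Section MatrixEntries.
Variables (R : realType) (n : nat).
Implicit Types A : 'M[R]_n.

Lemma ones_dgE A (i j : 'I_n) : (ones *m ones^T *m dg A) i j = A j j.
Proof.
rewrite mxE (bigD1 j)//= big1 ?addr0 => [|c /negPf cj].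
  by rewrite !mxE big_ord1 !mxE eqxx !mul1r.
by rewrite [dg A c j]mxE cj mulr0.
Qed.

Lemma col_onesE A (l i j : 'I_n) :
  (A *m (delta_mx l 0 : 'cV[R]_n) *m ones^T) i j = A i l.
Proof. by rewrite -colE mxE big_ord1 !mxE mulr1. Qed.

Lemma mulmx_invdiagE A (d : 'rV[R]_n) i j : (forall k, d 0 k != 0) ->
  (A *m invmx (diag_mx d)) i j = A i j / d 0 j.
Proof.
move=> d0; have du : diag_mx d \in unitmx.
  by rewrite unitmxE det_diag unitfE; apply/prodf_neq0 => k _.
by rewrite -[in RHS](mulmxKV du A) mul_mx_diag [in RHS]mxE mulfK.
Qed.

End MatrixEntries.

Lemma mean_weight_admissible (R : realType) n (E : rel 'I_n) (P : 'M[R]_n)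
    (G : weighted_graph E P) :
  finite_moments G -> admissible_mean E (mean_weight G).
Proof.
move=> finG a b; split=> [Eab|nE]; last first.
  have := integral_wt finG 0%N a b.
  by under eq_integral do rewrite wg_wt_nonedge//; rewrite integral0 => -[].
have [eps eps0 wt_eps] := wg_wt_edge G.
apply: (lt_le_trans eps0); rewrite -lee_fin -(integral_wt finG 0%N a b).
have -> : (eps%:E = \int[wg_prob G]_t (cst eps%:E t))%E.
  rewrite integral_cst// -[LHS]mule1; congr (_ * _)%E.
  exact/esym/probability_setT.
apply: ge0_le_integral => //.
- by move=> t _ /=; rewrite lee_fin ltW.
- by apply/measurable_EFinP.
- by move=> t _; rewrite lee_fin; exact: wt_eps.
Qed.

(** An edge has positive mean weight, hence can be perturbed in both directions. *)
Lemma admissible_near (R : realType) n (E : rel 'I_n) (W : 'M[R]_n) l k :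
  admissible_mean E W -> E l k ->
  \forall h \near (0 : R)^', admissible_mean E (h *: delta_mx l k + W).
Proof.
move=> admW Elk; have Wlk : 0 < W l k by have [+ _] := admW l k; apply.
near=> h.
have hW : `|h| < W l k by near: h; exact: dnbhs0_lt.
move=> a b; rewrite !mxE; have [W0 W1] := admW a b.
have [/andP[/eqP -> /eqP ->]|ne] := boolP ((a == l) && (b == k)).
  rewrite Elk mulr1; split=> // _.
  by rewrite -ltrBlDr sub0r; have := hW; rewrite ltr_norml => /andP[].
by rewrite mulr0 add0r.
Unshelve. all: by end_near. Qed.
(* [Gt] is any family of weighted graphs over the same [E] and [P], indexed by
   its matrix of mean weights and passing through [G]; M as a function of the
   mean weights is [fun W => mean_passage (Gt W)]. *)
Theorem lemma2 (R : realType) (n : nat) (E : rel 'I_n) (P : 'M[R]_n)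
    (pi : 'rV[R]_n) (G : weighted_graph E P)
    (Gt : 'M[R]_n -> weighted_graph E P) (l k : 'I_n) :
  markovian_graph E P ->
  assumption_A G pi ->
  Gt (mean_weight G) = G ->
  (forall W, admissible_mean E W ->
     assumption_A (Gt W) pi /\ mean_weight (Gt W) = W) ->
  E l k ->
  let Z := fundamental P pi in
  let e_l : 'cV[R]_n := delta_mx l 0 in
  let J : 'M[R]_n := ones *m ones^T in
  is_derive (mean_weight G) (delta_mx l k : 'M[R]_n)
    (fun W : 'M[R]_n => mean_passage (Gt W))
    (P l k *: (Z *m e_l *m ones^T - J *m dg (Z *m e_l *m ones^T)
       + pi 0 l *: ((1%:M - Z + J *m dg Z) *m invmx (diag_mx pi)))).
Proof.
move=> [_ Psto _ Pirr _] [[pistat _] finG] _ GtW Elk Z e_l J.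
have passageE W' : admissible_mean E W' -> forall i j,
    mean_passage (Gt W') i j = \sum_(e : 'I_n * 'I_n)
      taboo_green P pi j i e.1 * (P e.1 e.2 * W' e.1 e.2).
  move=> /GtW[[_ finW] meanW] i j.
  by rewrite (mean_passageE i j Psto finW Pirr pistat) meanW.
move: (mean_weight G) (mean_weight_admissible finG) => W admW.
set D := P l k *: _.
have DE i j : D i j = taboo_green P pi j i l * P l k.
  have pi0 c : pi 0 c != 0 by rewrite gt_eqF// (stationary_gt0 Psto Pirr pistat).
  rewrite mulrC /D /J /e_l mxE; congr (_ * _).
  rewrite mxE [X in X + _]mxE [X in _ + X + _]mxE ones_dgE !col_onesE.
  rewrite [X in _ + X]mxE mulmx_invdiagE// mxE [X in (X + _) / _]mxE ones_dgE.
  by rewrite [1%:M _ _]mxE [(- Z) _ _]mxE [RHS]mxE mulrA mulrAC.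
suff cvgD : h^-1 *: ((fun W' => mean_passage (Gt W')) (h *: delta_mx l k + W)
      - mean_passage (Gt W)) @[h --> (0 : R)^'] --> D.
  split; last exact: cvg_lim.
  by apply/cvg_ex; exists D.
(* The mean passage times are linear on admissible matrices, so the difference
   quotient is constant near zero. *)
apply: cvg_near_cst; near=> h.
have h0 : h != 0 by near: h; exact: nbhs_dnbhs_neq.
have admh : admissible_mean E (h *: delta_mx l k + W).
  by near: h; exact: admissible_near.
have WhE a b : (h *: delta_mx l k + W) a b =
    h * ((a == l) && (b == k))%:R + W a b by rewrite !mxE.
apply/matrixP => i j; rewrite DE [LHS]mxE [X in _ * X = _]mxE.
rewrite [X in _ * (_ + X) = _]mxE !passageE// -sumrB.
rewrite (bigD1 (l, k))//= big1 => [|[a b] /= ne].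
  by rewrite WhE !eqxx mulr1n; field.
by rewrite WhE -xpair_eqE (negPf ne) mulr0n; ring.
Unshelve. all: by end_near. Qed.
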